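(* Let $(X,d)$ be a (nonempty) complete metric space, let $N\ge1$, let $\psi,\phi_1,\dots,\phi_N:(0,\infty)\to\mathbb{R}$ be functions, and for $i=1,\dots,N$ let $w_i:X\times X\to X$ be a continuous map such that for all $(x,y),(u,v)\in X\times X$ with $d(w_i(x,y),w_i(u,v))>0$, $$\psi\big(d(w_i(x,y),w_i(u,v))\big)\le\phi_i\big(\max\{d(x,u),d(y,v)\}\big).$$ Suppose that: (i) $\psi$ and $\phi_i$ are nondecreasing for $i=1,\dots,N$; (ii) $\phi_i(t)<\psi(t)$ for every $t>0$ and $i=1,\dots,N$; (iii) $\limsup_{t\to\epsilon+}\phi_i(t)<\psi(\epsilon+)$ for every $\epsilon>0$ and $i=1,\dots,N$. Then there exists a unique pair $(A^*,B^* )\in\mathcal{H}(X)\times\mathcal{H}(X)$ such that $$A^*=\bigcup_{i=1}^N w_i(A^*,B^* ),\qquad B^*=\bigcup_{i=1}^N w_i(B^*,A^* ).$$ Moreover, for any $(A,B)\in\mathcal{H}(X)\times\mathcal{H}(X)$, the sequences defined by $A_0=A$, $B_0=B$ and $$A_n=\bigcup_{i=1}^N w_i(A_{n-1},B_{n-1}),\qquad B_n=\bigcup_{i=1}^N w_i(B_{n-1},A_{n-1})\quad(n\ge1)$$ converge in $(\mathcal{H}(X),h_d)$ to $A^*$ and $B^*$ respectively.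
   Context: $\mathcal{H}(X)$ is the set of all nonempty compact subsets of $X$, with the Hausdorff metric $h_d(A,B)=\max\{\max_{x\in A}\min_{y\in B}d(x,y),\ \max_{x\in B}\min_{y\in A}d(x,y)\}$. For $A,B\in\mathcal{H}(X)$, $w_i(A,B)=\{w_i(a,b):a\in A,\ b\in B\}$. $\psi(\epsilon+)$ denotes the right-hand limit of $\psi$ at $\epsilon$. *)

(* Defs.v *)
From HB Require Import structures.
From mathcomp Require Import all_boot all_order all_algebra.
From mathcomp Require Import all_classical all_reals all_analysis.
From mathcomp Require Import lra.

Set Implicit Arguments.
Unset Strict Implicit.
Unset Printing Implicit Defensive.

Import Order.TTheory GRing.Theory Num.Theory.
Import numFieldNormedType.Exports.

Local Open Scope classical_set_scope.
Local Open Scope ring_scope.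

(* [Complete] extends [Pointed], so these metric spaces are nonempty. *)
#[short(type="completeMetricType")]
HB.structure Definition CompleteMetric (K : numFieldType) :=
  {T of Complete T & Metric K T}.

Definition hyperspace (R : realType) (X : metricType R) : set (set X) :=
  [set A | A !=set0 /\ compact A].

Definition dist_to_set (R : realType) (X : metricType R) (x : X) (B : set X)
    : R :=
  inf [set mdist x y | y in B].

Definition excess (R : realType) (X : metricType R) (A B : set X) : R :=
  sup [set dist_to_set x B | x in A].

(* On [hyperspace X] the sup and the infs are a max and mins: see
   [dist_to_set_min] and [excess_max] below. *)
Definition hausdorff_dist (R : realType) (X : metricType R) (A B : set X) : R :=
  Num.max (excess A B) (excess B A).

Definition hyperspace_cvg (R : realType) (X : metricType R)
    (A_ : nat -> set X) (L : set X) : Prop :=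
  [/\ forall n, hyperspace (A_ n), hyperspace L
    & (hausdorff_dist (A_ n) L @[n --> \oo] --> (0 : R))].

Definition ifs_image (X : Type) (N : nat) (w : 'I_N -> X * X -> X)
    (A B : set X) : set X :=
  \bigcup_(i in [set: 'I_N]) (w i @` (A `*` B)).

Section attained.
Variables (R : realType) (X : metricType R).
Implicit Types (x y : X) (A B : set X).

Lemma mdist_continuous x : continuous (mdist x : X -> R).
Proof.
move=> y; apply/cvgrPdist_le => /= e e0; near=> z.
have yz : mdist y z <= e.
  near: z.
  apply: (@metricType_numDomainType.cvgr_dist_le _ _ _ _ _ id y) => //.
have h1 := metric_triangle x y z; have h2 := metric_triangle x z y.
rewrite (metric_sym z y) in h2.
by rewrite ler_norml; apply/andP; split; lra.
Unshelve. all: by end_near. Qed.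

Lemma dist_to_set_min x B : hyperspace B ->
  exists2 y, B y & dist_to_set x B = mdist x y /\
                   forall z, B z -> mdist x y <= mdist x z.
Proof.
move=> [B0 cB].
have [|y By ymin] := @compact_EVT_min X R (mdist x) B B0 cB.
  by apply: continuous_subspaceT; exact: mdist_continuous.
have yB : B y by rewrite inE in By.
have ymin' z : B z -> mdist x y <= mdist x z by move=> Bz; apply: ymin; rewrite inE.
exists y => //; split=> //; apply/eqP; rewrite eq_le; apply/andP; split.
  apply: ge_inf; last by exists y.
  by exists 0 => _ [z _ <-]; exact: mdist_ge0.
by apply: lb_le_inf; [exists (mdist x y), y | move=> _ [z Bz <-]; exact: ymin'].
Qed.

Lemma dist_to_set_continuous B : hyperspace B ->
  continuous (fun x => dist_to_set x B).
Proof.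
move=> HB.
have lip x z : dist_to_set x B <= mdist x z + dist_to_set z B.
  have [y By [-> _]] := dist_to_set_min z HB.
  have [y' _ [-> /(_ y By)]] := dist_to_set_min x HB.
  by move=> /le_trans; apply; exact: metric_triangle.
move=> y; apply/cvgrPdist_le => /= e e0; near=> z.
have yz : mdist y z <= e.
  near: z.
  apply: (@metricType_numDomainType.cvgr_dist_le _ _ _ _ _ id y) => //.
have h1 := lip y z; have h2 := lip z y; rewrite (metric_sym z y) in h2.
by rewrite ler_norml; apply/andP; split; lra.
Unshelve. all: by end_near. Qed.

Lemma excess_max A B : hyperspace A -> hyperspace B ->
  exists2 x, A x & excess A B = dist_to_set x B /\
                   forall z, A z -> dist_to_set z B <= dist_to_set x B.
Proof.
move=> [A0 cA] HB.
have [|x Ax xmax] :=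
    @compact_EVT_max X R (fun x => dist_to_set x B) A A0 cA.
  by apply: continuous_subspaceT; exact: dist_to_set_continuous.
have xA : A x by rewrite inE in Ax.
have xmax' z : A z -> dist_to_set z B <= dist_to_set x B.
  by move=> Az; apply: xmax; rewrite inE.
exists x => //; split=> //; apply/eqP; rewrite eq_le; apply/andP; split.
  by apply: ge_sup; [exists (dist_to_set x B), x
                    | move=> _ [z Az <-]; exact: xmax'].
apply: ub_le_sup; last by exists x.
by exists (dist_to_set x B) => _ [z Az <-]; exact: xmax'.
Qed.

End attained.

(* Main.v *)
(* Pointwise the hypotheses give two facts: every [w i] strictly decreases a
   positive distance, and for each [e > 0] there is [delta > 0] such that points
   at distance [< e + delta] have images at distance [<= e] (a Meir-Keeler
   condition). Both pass to the map [(A, B) |-> (F A B, F B A)] for the maximum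
   of the two Hausdorff distances: the first because these distances are
   attained, the second directly. Two orbits of such a map get arbitrarily close
   and every orbit is Cauchy, so the completeness of the hyperspace yields the
   fixed point. For a Cauchy sequence [A_ n] of compact sets the limit is the set
   of points eventually close to [A_ n]; its compactness and the approximation of
   points of [A_ n] both come from the convergence of every ultrafilter that
   contains arbitrarily thin neighbourhoods of compact sets. *)
Require Import Defs.
From HB Require Import structures.
From mathcomp Require Import all_boot all_order all_algebra.
From mathcomp Require Import all_classical all_reals all_analysis.
From mathcomp Require Import lra.

Set Implicit Arguments.
Unset Strict Implicit.
Unset Printing Implicit Defensive.

Import Order.TTheory GRing.Theory Num.Theory.
Import numFieldNormedType.Exports.

Local Open Scope classical_set_scope.
Local Open Scope ring_scope.

(** * Fixed-point theory of Meir-Keeler maps *)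

Section meir_keeler.
Variables (R : realType) (Y : Type) (D : set Y) (d : Y -> Y -> R) (f : Y -> Y).
Hypothesis d_ge0 : forall x y, D x -> D y -> 0 <= d x y.
Hypothesis d_triangle : forall y x z, D y -> D x -> D z ->
  d x z <= d x y + d y z.
Hypothesis fD : forall x, D x -> D (f x).
Hypothesis f_contractive : forall x y, D x -> D y ->
  0 < d x y -> d (f x) (f y) < d x y.
Hypothesis f_meir_keeler : forall e, 0 < e -> exists2 delta, 0 < delta &
  forall x y, D x -> D y -> d x y < e + delta -> d (f x) (f y) <= e.

Lemma iter_stable n x : D x -> D (iter n f x).
Proof. by move=> Dx; elim: n => //= n; exact: fD. Qed.

(** At distance 0, where [f_contractive] is silent, [f_meir_keeler] bounds the image distance by
    every [e > 0]. *)
Lemma contractive_le x y : D x -> D y -> d (f x) (f y) <= d x y.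
Proof.
move=> Dx Dy; have := d_ge0 Dx Dy.
rewrite le_eqVlt => /orP[/eqP d0|d0]; last exact/ltW/f_contractive.
apply/ler_addgt0Pl => e e0; have [delta delta0 H] := f_meir_keeler e0.
by rewrite -d0 addr0; apply: H => //; rewrite -d0 addr_gt0.
Qed.

(** The distances decrease to their infimum. Were it positive, the Meir-Keeler condition there would
    bring some term down to it, and strict contraction would push the next term below it. *)
Lemma iter_cvg0 x y : D x -> D y ->
  d (iter n f x) (iter n f y) @[n --> \oo] --> (0 : R).
Proof.
move=> Dx Dy; pose u n := d (iter n f x) (iter n f y).
have u_ge0 n : 0 <= u n by apply: d_ge0; exact: iter_stable.
have u_lb : has_lbound (range u) by exists 0 => _ [n _ <-].
have u_dec : {homo u : n m / (n <= m)%N >-> m <= n}.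
  apply/nonincreasing_seqP => n; apply: contractive_le; exact: iter_stable.
have cu : u @ \oo --> inf (range u) by exact: nonincreasing_cvgn.
suff u0 : inf (range u) = 0 by rewrite u0 in cu.
have l_le n : inf (range u) <= u n by apply: ge_inf => //; exists n.
apply/eqP/negPn/negP => l_neq0.
have l_gt0 : 0 < inf (range u).
  rewrite lt_neqAle eq_sym l_neq0; apply: lb_le_inf; first by exists (u 0%N), 0%N.
  by move=> _ [n _ <-].
have [delta delta0 H] := f_meir_keeler l_gt0.
have [|_ [n _ <-] un] := inf_adherent delta0 (E := range u).
  by split => //; exists (u 0%N), 0%N.
have u1 : u n.+1 <= inf (range u) by apply: H => //; exact: iter_stable.
have : u n.+2 < u n.+1.
  apply: f_contractive; [exact: (iter_stable n.+1)..|].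
  exact: lt_le_trans l_gt0 (l_le n.+1).
by rewrite ltNge (le_trans u1).
Qed.

(* Once [d x_n x_{n+1} < delta], the ball of radius [e + delta] around [x_n]
   contains the whole tail of the orbit. *)
Lemma iter_cauchy x : D x -> forall e, 0 < e ->
  exists n, forall m, (n < m)%N -> d (iter n f x) (iter m f x) <= e.
Proof.
move=> Dx e e0; have [delta delta0 H] := f_meir_keeler e0.
have /cvgrPdist_lt/(_ _ delta0)[n _ nP] := iter_cvg0 Dx (fD Dx).
have Dn k : D (iter k f x) by exact: iter_stable.
have := nP n (leqnn n); rewrite /= sub0r normrN -iterSr ger0_norm ?d_ge0// => dn.
have tail k : d (iter n f x) (iter (n + k).+1 f x) < e + delta.
  elim: k => [|k IH]; first by rewrite addn0 (lt_trans dn)// ltrDr.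
  have h := H _ _ (Dn n) (Dn (n + k).+1) IH.
  apply: le_lt_trans (d_triangle (Dn n.+1) (Dn n) (Dn (n + k.+1).+1)) _.
  by rewrite addrC ler_ltD// addnS.
(* One more application of [f] improves the bound [e + delta] to [e]; hence the index [n.+1]. *)
exists n.+1 => -[//|m]; rewrite ltnS => nm.
rewrite !iterS; apply: H => //.
by have := tail (m - n.+1)%N; rewrite -addSn subnKC.
Qed.

(** As [f] does not increase distances, [f l] is close to [x_{n+1}], which is close to [l]. *)
Lemma iter_lim_fixed x l : (forall y z, d y z = d z y) -> D x -> D l ->
  d (iter n f x) l @[n --> \oo] --> (0 : R) -> d l (f l) <= 0.
Proof.
move=> d_sym Dx Dl cl; apply/ler_addgt0Pl => e e0; rewrite addr0.
have e2 : 0 < e / 2 by rewrite divr_gt0.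
have /cvgrPdist_lt/(_ _ e2)[n _ nP] := cl.
have Dn k : D (iter k f x) by exact: iter_stable.
have := nP n.+1 (leqnSn n); have := nP n (leqnn n).
rewrite /= !sub0r !normrN !ger0_norm ?d_ge0//; last exact: fD.
move=> d1 d2; have := contractive_le (Dn n) Dl.
have := d_triangle (Dn n.+1) Dl (fD Dl); rewrite (d_sym l (iter n.+1 f x)) /=; lra.
Qed.

End meir_keeler.

(** * The Hausdorff distance through fattenings *)

Section hyperspace.
Variables (R : realType) (X : metricType R).
Implicit Types (A B C : set X) (e : R).

(** The bound is non-strict because distances to compact sets are attained; this makes [excess_leP]
    an equivalence. *)
Definition in_fattening e A B := forall x, A x -> exists2 y, B y & mdist x y <= e.

Lemma in_fattening_trans B A C e e' :
  in_fattening e A B -> in_fattening e' B C -> in_fattening (e + e') A C.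
Proof.
move=> AB BC x /AB[y /BC[z Cz yz] xy]; exists z => //.
by rewrite (le_trans (metric_triangle x y z))// lerD.
Qed.

Lemma dist_to_set_le x y B : hyperspace B -> B y -> dist_to_set x B <= mdist x y.
Proof. by move=> HB By; have [z _ [->]] := dist_to_set_min x HB; exact. Qed.

Lemma excess_leP A B e : hyperspace A -> hyperspace B ->
  excess A B <= e <-> in_fattening e A B.
Proof.
move=> HA HB; have [x Ax [-> xP]] := excess_max HA HB; split => [xe z Az|AB].
  have [y By [zy _]] := dist_to_set_min z HB.
  by exists y => //; rewrite -zy (le_trans (xP _ Az)).
by have [y By xy] := AB _ Ax; exact: le_trans (dist_to_set_le x HB By) xy.
Qed.

Lemma hausdorff_leP A B e : hyperspace A -> hyperspace B ->
  hausdorff_dist A B <= e <-> in_fattening e A B /\ in_fattening e B A.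
Proof.
move=> HA HB; rewrite /hausdorff_dist ge_max.
split => [/andP[]|[]] /excess_leP h1 /excess_leP h2; first by split; auto.
by apply/andP; split; auto.
Qed.

Lemma hausdorff_in_fattening A B : hyperspace A -> hyperspace B ->
  in_fattening (hausdorff_dist A B) A B /\ in_fattening (hausdorff_dist A B) B A.
Proof. by move=> HA HB; exact/hausdorff_leP. Qed.

Lemma hausdorff_sym A B : hausdorff_dist A B = hausdorff_dist B A.
Proof. by rewrite /hausdorff_dist maxC. Qed.

Lemma hausdorff_ge0 A B : hyperspace A -> hyperspace B -> 0 <= hausdorff_dist A B.
Proof.
move=> HA HB; have [AB _] := hausdorff_in_fattening HA HB.
by case: HA => -[x /AB[y _ xy]] _; exact: le_trans (mdist_ge0 _ _) xy.
Qed.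

Lemma hausdorff_triangle B A C : hyperspace A -> hyperspace B -> hyperspace C ->
  hausdorff_dist A C <= hausdorff_dist A B + hausdorff_dist B C.
Proof.
move=> HA HB HC; apply/hausdorff_leP => //.
have [AB BA] := hausdorff_in_fattening HA HB; have [BC CB] := hausdorff_in_fattening HB HC.
by split; [|rewrite addrC]; apply: in_fattening_trans; eassumption.
Qed.

Lemma hausdorff_eq0 A B : hyperspace A -> hyperspace B ->
  hausdorff_dist A B <= 0 -> A = B.
Proof.
have in_fattening0 C C' : in_fattening 0 C C' -> C `<=` C'.
  move=> CC' x /CC'[y C'y xy]; suff -> : x = y by [].
  by apply/mdist_positivity/eqP; rewrite eq_le xy mdist_ge0.
move=> HA HB /hausdorff_leP[//|//|AB BA].
by apply/seteqP; split; exact: in_fattening0.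
Qed.

End hyperspace.

(** * Completeness of the hyperspace *)

Section completeness.
Variables (R : realType) (X : completeMetricType R).

(** Moving points to nearby points of [C] pushes [F] to a filter on [C], which clusters at some [c].
    Since [F] is an ultrafilter, clustering already puts a ball around [c] in [F], so [F] is
    Cauchy. *)
Lemma ultra_near_compact_cvg (F : set_system X) : UltraFilter F ->
  (forall e : R, 0 < e -> exists2 C : set X, compact C &
    F [set x | exists2 c, C c & mdist x c <= e]) ->
  cvg F.
Proof.
move=> UF H; apply: cauchy_cvg; apply: cauchy_exP => e e0.
have e2 : 0 < e / 2 by rewrite divr_gt0.
have [C cC FC] := H _ e2.
have /choice[p pP] (x : X) : exists y,
    (exists2 c, C c & mdist x c <= e / 2) -> C y /\ mdist x y <= e / 2.
  have [[c Cc xc]|nC] := pselect (exists2 c, C c & mdist x c <= e / 2).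
    by exists c.
  by exists x.
have pC : (p x @[x --> F]) C.
  by rewrite /fmap /=; apply: filterS FC => x /pP[].
have [c [Cc clc]] := cC _ _ pC.
exists c; pose B := p @^-1` ball c (e / 2).
(* If the complement of [B] were in [F], the pushforward would avoid the ball around its cluster
   point. *)
have [FB|FnB] := in_ultra_setVsetC B UF.
  apply: filterS (filterI FB FC) => x [Bx /pP[_ xp]].
  move: Bx; rewrite /B /= !ballEmdist /= => cp.
  have := metric_triangle c (p x) x; rewrite (metric_sym (p x) x); lra.
have [y [nBy]] := clc (~` ball c (e / 2)) (ball c (e / 2)) FnB (nbhsx_ballx c _ e2).
by move=> /nBy.
Qed.

(** This is the Kuratowski lower limit of the sequence. *)
Definition eventually_near (A_ : nat -> set X) : set X :=
  [set x | forall e : R, 0 < e -> exists n, forall m, (n <= m)%N ->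
     exists2 a, A_ m a & mdist x a <= e].

Lemma hyperspace_complete (A_ : nat -> set X) :
  (forall n, hyperspace (A_ n)) ->
  (forall e : R, 0 < e -> exists n, forall m k, (n <= m)%N -> (n <= k)%N ->
     in_fattening e (A_ m) (A_ k)) ->
  exists L, hyperspace_cvg A_ L.
Proof.
move=> HA cauchyA; pose L := eventually_near A_.
have limL (F : set_system X) (l : X) : ProperFilter F -> F --> l ->
    (forall e : R, 0 < e -> exists n, forall m, (n <= m)%N ->
      F [set x | exists2 a, A_ m a & mdist x a <= e]) -> L l.
  move=> PF Fl FA e e0; have e2 : 0 < e / 2 by rewrite divr_gt0.
  have [n nP] := FA _ e2; exists n => m /nP Fm.
  have [x [[a Aa xa]]] := filter_ex (filterI Fm (Fl _ (nbhsx_ballx l _ e2))).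
  rewrite ballEmdist /= => lx; exists a => //.
  by have := metric_triangle l x a; lra.
have ultraL (F : set_system X) : UltraFilter F ->
    (forall e : R, 0 < e -> exists n, forall m, (n <= m)%N ->
      F [set x | exists2 a, A_ m a & mdist x a <= e]) -> exists2 l, L l & F --> l.
  move=> UF FA; have cF : cvg F.
    apply: ultra_near_compact_cvg => e /FA[n nP].
    by exists (A_ n); [case: (HA n)|exact: nP].
  by exists (lim F) => //; apply: limL cF FA.
(* A point of [L] is within [e'] of [A_ k] for some late [k], and the Cauchy bound leads from [A_ k]
   back to [A_ m]. *)
have L_near n e : (forall m k, (n <= m)%N -> (n <= k)%N -> in_fattening e (A_ m) (A_ k)) ->
    forall m e', (n <= m)%N -> 0 < e' -> in_fattening (e' + e) L (A_ m).
  move=> nP m e' nm e'0 x /(_ _ e'0)[k kP].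
  have [a Aa xa] := kP (maxn n k) (leq_maxr _ _).
  have [b Ab ab] := nP _ m (leq_maxl n k) nm a Aa.
  exists b => //; have := metric_triangle x a b; lra.
(* Points [g k] of [A_ k] within [e] of [a] are chosen for [k >= n]. An ultrafilter refining the
   tails of [g] converges to the required point of [L]; the second [e] pays for passing to that
   limit. *)
have near_L n e : 0 < e ->
    (forall m k, (n <= m)%N -> (n <= k)%N -> in_fattening e (A_ m) (A_ k)) ->
    forall m, (n <= m)%N -> in_fattening (e + e) (A_ m) L.
  move=> e0 nP m nm a Aa.
  have /choice[g gP] k : exists x, (n <= k)%N -> A_ k x /\ mdist a x <= e.
    have [nk|] := boolP (n <= k)%N; last by exists a.
    by have [b Ab ab] := nP m k nm nk a Aa; exists b.
  have [F [UF gF]] := ultraFilterLemma (fmap_proper_filter g eventually_filter).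
  have [|l Ll Fl] := ultraL F UF.
    move=> e' /cauchyA[n' n'P]; exists n' => k n'k; apply: gF.
    exists (maxn n n') => // j; rewrite /= geq_max => /andP[nj n'j].
    exact: n'P (gP _ nj).1.
  exists l => //.
  have Fa : F [set x | mdist a x <= e].
    by apply: gF; exists n => // k /gP[].
  have [x [/= ax]] := filter_ex (filterI Fa (Fl _ (nbhsx_ballx l _ e0))).
  rewrite ballEmdist /= metric_sym => xl.
  have := metric_triangle a x l; lra.
have HL : hyperspace L.
  split.
    have [n nP] := cauchyA _ ltr01; have [[a Aa] _] := HA n.
    by have [l Ll _] := near_L n 1 ltr01 nP n (leqnn n) a Aa; exists l.
  rewrite compact_ultra => F UF FL.
  have [|l Ll Fl] := ultraL F UF; last by exists l.
  (* [L] lies in the [e]-fattening of every late [A_ m], so an ultrafilter containing [L] contains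
     these fattenings. *)
  move=> e e0; have e2 : 0 < e / 2 by rewrite divr_gt0.
  have [n nP] := cauchyA _ e2; exists n => m nm.
  apply: filterS FL => x Lx; have := L_near _ _ nP m _ nm e2 x Lx.
  by rewrite -splitr.
exists L; split => //; apply/cvgrPdist_le => e e0.
have e2 : 0 < e / 2 by rewrite divr_gt0.
have [n nP] := cauchyA _ e2; exists n => // m nm /=.
rewrite sub0r normrN ger0_norm ?hausdorff_ge0//.
apply/hausdorff_leP => //; rewrite [e]splitr; split.
  exact: near_L nm.
exact: L_near nm e2.
Qed.

End completeness.

(** * Transfer of pointwise bounds to the set operator *)

Section ifs.
Variables (R : realType) (X : metricType R) (N : nat) (w : 'I_N -> X * X -> X).
Implicit Types A B C D : set X.

Lemma ifs_image_hyperspace A B : (1 <= N)%N -> (forall i, continuous (w i)) ->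
  hyperspace A -> hyperspace B -> hyperspace (ifs_image w A B).
Proof.
move=> hN cw [[a Aa] cA] [[b Bb] cB]; split.
  by exists (w (Ordinal hN) (a, b)); exists (Ordinal hN) => //; exists (a, b).
(* The union is rewritten over a finite enumeration, where compactness is preserved. *)
rewrite /ifs_image (_ : [set: 'I_N] = [set` index_enum 'I_N]); last first.
  by apply/seteqP; split => i //= _; rewrite mem_index_enum.
rewrite bigcup_seq; apply: bigsetU_compact => i _.
apply: continuous_compact; last exact: compact_setX.
by apply: continuous_subspaceT; exact: cw.
Qed.

Lemma ifs_image_in_fattening A B C D (r e : R) :
  (forall i a b c d, mdist a c <= r -> mdist b d <= r ->
    mdist (w i (a, b)) (w i (c, d)) <= e) ->
  in_fattening r A C -> in_fattening r B D ->
  in_fattening e (ifs_image w A B) (ifs_image w C D).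
Proof.
move=> H AC BD _ [i _ [[a b] /= [/AC[c Cc ac] /BD[d Dd bd]] <-]].
by exists (w i (c, d)); [exists i => //; exists (c, d)|exact: H].
Qed.

(** Strictness survives the supremum because the excess is attained at a point of the image. *)
Lemma ifs_image_excess_lt A B C D (r : R) :
  (forall i a b c d, mdist a c <= r -> mdist b d <= r ->
    mdist (w i (a, b)) (w i (c, d)) < r) ->
  hyperspace (ifs_image w A B) -> hyperspace (ifs_image w C D) ->
  in_fattening r A C -> in_fattening r B D ->
  excess (ifs_image w A B) (ifs_image w C D) < r.
Proof.
move=> H HAB HCD AC BD; have [_ [i _ [[a b] /= [Aa Bb] <-]] [-> _]] := excess_max HAB HCD.
have [[c Cc ac] [d Dd bd]] := (AC _ Aa, BD _ Bb).
apply: le_lt_trans (H i _ _ _ _ ac bd); apply: dist_to_set_le => //.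
by exists i => //; exists (c, d).
Qed.

Lemma ifs_image_hausdorff_lt A B C D (r : R) :
  (forall i a b c d, mdist a c <= r -> mdist b d <= r ->
    mdist (w i (a, b)) (w i (c, d)) < r) ->
  hyperspace A -> hyperspace B -> hyperspace C -> hyperspace D ->
  hyperspace (ifs_image w A B) -> hyperspace (ifs_image w C D) ->
  hausdorff_dist A C <= r -> hausdorff_dist B D <= r ->
  hausdorff_dist (ifs_image w A B) (ifs_image w C D) < r.
Proof.
move=> H HA HB HC HD HAB HCD /hausdorff_leP[//|//|AC CA] /hausdorff_leP[//|//|BD DB].
by rewrite /hausdorff_dist gt_max !ifs_image_excess_lt.
Qed.

Lemma ifs_image_hausdorff_le A B C D (r e : R) :
  (forall i a b c d, mdist a c <= r -> mdist b d <= r ->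
    mdist (w i (a, b)) (w i (c, d)) <= e) ->
  hyperspace A -> hyperspace B -> hyperspace C -> hyperspace D ->
  hyperspace (ifs_image w A B) -> hyperspace (ifs_image w C D) ->
  hausdorff_dist A C <= r -> hausdorff_dist B D <= r ->
  hausdorff_dist (ifs_image w A B) (ifs_image w C D) <= e.
Proof.
move=> H HA HB HC HD HAB HCD /hausdorff_leP[//|//|AC CA] /hausdorff_leP[//|//|BD DB].
by apply/hausdorff_leP => //; split; apply: ifs_image_in_fattening H _ _.
Qed.

End ifs.

(** * Consequences of the hypotheses on [psi] and [phi] *)

Section pointwise.
Variables (R : realType) (X : metricType R) (N : nat).
Variables (psi : R -> R) (phi : 'I_N -> R -> R) (w : 'I_N -> X * X -> X).
Hypothesis w_contractive : forall i (x y u v : X),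
  0 < mdist (w i (x, y)) (w i (u, v)) ->
  psi (mdist (w i (x, y)) (w i (u, v)))
    <= phi i (Num.max (mdist x u) (mdist y v)).
Hypothesis psi_nondecreasing : forall s t : R, 0 < s -> s <= t -> psi s <= psi t.
Hypothesis phi_nondecreasing : forall i (s t : R),
  0 < s -> s <= t -> phi i s <= phi i t.

(** Monotonicity of [phi i] is assumed from positive arguments on. The maximum is positive here:
    otherwise [a = c] and [b = d], and the images coincide. *)
Lemma w_phi i (r : R) a b c d : 0 < mdist (w i (a, b)) (w i (c, d)) ->
  mdist a c <= r -> mdist b d <= r ->
  psi (mdist (w i (a, b)) (w i (c, d))) <= phi i r.
Proof.
move=> dw ac bd; apply: le_trans (w_contractive dw) _.
apply: phi_nondecreasing; last by rewrite ge_max ac.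
rewrite lt_neqAle le_max mdist_ge0 andbT; apply/eqP => m0.
have eq0 (x y : X) : mdist x y <= Num.max (mdist a c) (mdist b d) -> x = y.
  rewrite -m0 => xy.
  by apply/mdist_positivity/eqP; rewrite eq_le xy mdist_ge0.
move: dw; rewrite (eq0 a c) ?le_max ?lexx// (eq0 b d) ?le_max ?lexx ?orbT//.
by rewrite mdistxx ltxx.
Qed.

(** An image distance [s >= r] would give [psi s <= phi i r < psi r <= psi s]. *)
Lemma w_lt : (forall i (t : R), 0 < t -> phi i t < psi t) ->
  forall r : R, 0 < r -> forall i a b c d, mdist a c <= r -> mdist b d <= r ->
  mdist (w i (a, b)) (w i (c, d)) < r.
Proof.
move=> phi_psi r r0 i a b c d ac bd; rewrite ltNge; apply/negP => rw.
have := w_phi (lt_le_trans r0 rw) ac bd; rewrite leNgt => /negP; apply.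
exact: lt_le_trans (phi_psi _ _ r0) (psi_nondecreasing r0 rw).
Qed.

Lemma lim_at_right_le (e s : R) : 0 < e -> e < s ->
  lim (psi t @[t --> e^'+]) <= psi s.
Proof.
move=> e0 es; apply: limr_le.
  (* The right limit exists since [psi] is monotone and bounded below by [psi e] to the right of
     [e]. *)
  apply: nondecreasing_at_right_is_cvgr; apply: nearW => x.
    move=> u v; rewrite !in_itv /= => /andP[eu _] _; apply: psi_nondecreasing.
    exact: lt_trans e0 eu.
  exists (psi e) => y [u /=]; rewrite in_itv /= => /andP[eu _] <-.
  exact: psi_nondecreasing (ltW eu).
near=> t; have et : e < t by near: t; exact: nbhs_right_gt.
apply: psi_nondecreasing; first exact: lt_trans e0 et.
by apply/ltW; near: t; exact: nbhs_right_lt.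
Unshelve. all: by end_near. Qed.

(* Some [t > e] has [phi i t < psi (e+)] for every [i]; then [delta := t - e]
   works, since an image distance [s > e] would give
   [psi (e+) <= psi s <= phi i t]. *)
Lemma w_meir_keeler : (forall i (e : R), 0 < e ->
    (limf_esup (fun t => (phi i t)%:E) e^'+
      < (lim (psi t @[t --> e^'+]))%:E)%E) ->
  forall e : R, 0 < e -> exists2 delta, 0 < delta &
    forall r, r < e + delta ->
    forall i a b c d, mdist a c <= r -> mdist b d <= r ->
    mdist (w i (a, b)) (w i (c, d)) <= e.
Proof.
move=> limsup_lt e e0.
have phi_near i : \forall t \near e^'+, phi i t < lim (psi t @[t --> e^'+]).
  (* The limsup is an infimum of suprema over right neighbourhoods, so some [V] has its supremum
     below the limit. *)
  have [_ [V eV <-] supV] := ereal_inf_lt (limsup_lt i e e0).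
  apply: filterS eV => t Vt; rewrite -lte_fin; apply: le_lt_trans supV.
  by apply: ereal_sup_ubound; exists t.
have [t [phi_t et]] :=
  filter_ex (filterI (filter_forall _ phi_near) (nbhs_right_gt e)).
exists (t - e); first by rewrite subr_gt0.
rewrite subrKC => r rt i a b c d ac bd; rewrite leNgt; apply/negP => ew.
have := w_phi (lt_trans e0 ew) (le_trans ac (ltW rt)) (le_trans bd (ltW rt)).
rewrite leNgt => /negP; apply; apply: lt_le_trans (phi_t i) _.
exact: lim_at_right_le.
Qed.

End pointwise.

(** * The product of two hyperspaces with the maximum distance *)

Section pair_space.
Variables (R : realType) (X : metricType R).

Definition pair_hyperspace : set (set X * set X) :=
  [set P | hyperspace P.1 /\ hyperspace P.2].

(** The maximum matches the one in the contraction hypothesis and is unchanged by swapping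
    coordinates, so it controls both components of [pair_ifs]. *)
Definition pair_dist (P Q : set X * set X) : R :=
  Num.max (hausdorff_dist P.1 Q.1) (hausdorff_dist P.2 Q.2).

Lemma pair_dist_ge0 P Q : pair_hyperspace P -> pair_hyperspace Q ->
  0 <= pair_dist P Q.
Proof. by move=> [P1 _] [Q1 _]; rewrite le_max hausdorff_ge0. Qed.

Lemma pair_dist_triangle Q P S :
  pair_hyperspace Q -> pair_hyperspace P -> pair_hyperspace S ->
  pair_dist P S <= pair_dist P Q + pair_dist Q S.
Proof.
move=> [Q1 Q2] [P1 P2] [S1 S2]; rewrite ge_max; apply/andP; split.
  apply: le_trans (hausdorff_triangle P1 Q1 S1) _.
  by rewrite lerD // le_max lexx.
apply: le_trans (hausdorff_triangle P2 Q2 S2) _.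
by rewrite lerD // le_max lexx orbT.
Qed.

Lemma pair_dist_eq0 P Q : pair_hyperspace P -> pair_hyperspace Q ->
  pair_dist P Q <= 0 -> P = Q.
Proof.
case: P Q => [A B] [C D] [/= HA HB] [/= HC HD]; rewrite ge_max => /andP[/= h1 h2].
by rewrite (hausdorff_eq0 HA HC h1) (hausdorff_eq0 HB HD h2).
Qed.

Lemma pair_dist_sym P Q : pair_dist P Q = pair_dist Q P.
Proof.
by rewrite /pair_dist (hausdorff_sym P.1 Q.1) (hausdorff_sym P.2 Q.2).
Qed.

Lemma pair_dist_cvg0P (P_ : nat -> set X * set X) Q :
  (forall n, pair_hyperspace (P_ n)) -> pair_hyperspace Q ->
  pair_dist (P_ n) Q @[n --> \oo] --> (0 : R) <->
  hyperspace_cvg (fst \o P_) Q.1 /\ hyperspace_cvg (snd \o P_) Q.2.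
Proof.
move=> HP HQ; have [Q1 Q2] := HQ.
have P1 n := (HP n).1; have P2 n := (HP n).2.
split => [PQ|[[_ _ c1] [_ _ c2]]].
  split; split => //; apply: (squeeze_cvgr _ (cvg_cst 0) PQ); apply: nearW => n.
    by rewrite hausdorff_ge0//= le_max lexx.
  by rewrite hausdorff_ge0//= le_max lexx orbT.
have c12 : hausdorff_dist (P_ n).1 Q.1 + hausdorff_dist (P_ n).2 Q.2
    @[n --> \oo] --> (0 : R).
  by rewrite -[0]addr0; exact: cvgD.
apply: (squeeze_cvgr _ (cvg_cst 0) c12); apply: nearW => n.
rewrite pair_dist_ge0//= ge_max lerDl lerDr !hausdorff_ge0//.
Qed.

End pair_space.

Lemma pair_hyperspace_complete (R : realType) (X : completeMetricType R)
    (P_ : nat -> set X * set X) :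
  (forall n, pair_hyperspace (P_ n)) ->
  (forall e : R, 0 < e -> exists n, forall m, (n < m)%N ->
     pair_dist (P_ n) (P_ m) <= e) ->
  exists2 L, pair_hyperspace L & pair_dist (P_ n) L @[n --> \oo] --> (0 : R).
Proof.
move=> HP cauchyP.
(* Comparing both indices with [n] costs [e / 2] each; [n.+1] makes the strict hypothesis apply. *)
have {}cauchyP (e : R) : 0 < e -> exists n, forall m k, (n <= m)%N -> (n <= k)%N ->
    pair_dist (P_ m) (P_ k) <= e.
  move=> e0; have e2 : 0 < e / 2 by rewrite divr_gt0.
  have [n nP] := cauchyP _ e2; exists n.+1 => m k /nP nm /nP nk.
  apply: le_trans (pair_dist_triangle (HP n) (HP m) (HP k)) _.
  by rewrite [e]splitr (pair_dist_sym (P_ m)) lerD.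
have P1 n := (HP n).1; have P2 n := (HP n).2.
have cauchyP1 (e : R) : 0 < e -> exists n, forall m k, (n <= m)%N -> (n <= k)%N ->
    in_fattening e (P_ m).1 (P_ k).1.
  move=> /cauchyP[n nP]; exists n => m k nm nk; have := nP m k nm nk.
  by rewrite ge_max => /andP[/hausdorff_leP[]].
have cauchyP2 (e : R) : 0 < e -> exists n, forall m k, (n <= m)%N -> (n <= k)%N ->
    in_fattening e (P_ m).2 (P_ k).2.
  move=> /cauchyP[n nP]; exists n => m k nm nk; have := nP m k nm nk.
  by rewrite ge_max => /andP[_ /hausdorff_leP[]].
have [L1 cL1] := hyperspace_complete P1 cauchyP1.
have [L2 cL2] := hyperspace_complete P2 cauchyP2.
have HL : pair_hyperspace (L1, L2) by case: cL1; case: cL2.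
by exists (L1, L2) => //; apply/pair_dist_cvg0P.
Qed.

(** * The coupled operator on pairs *)

Section pair_ifs.
Variables (R : realType) (X : metricType R) (N : nat) (w : 'I_N -> X * X -> X).

Definition pair_ifs (P : set X * set X) : set X * set X :=
  (ifs_image w P.1 P.2, ifs_image w P.2 P.1).

Hypothesis hN : (1 <= N)%N.
Hypothesis w_continuous : forall i, continuous (w i).

Lemma pair_ifs_hyperspace P : pair_hyperspace P -> pair_hyperspace (pair_ifs P).
Proof. by move=> [P1 P2]; split; exact: ifs_image_hyperspace. Qed.

Lemma pair_ifs_lt (r : R) P Q :
  (forall i a b c d, mdist a c <= r -> mdist b d <= r ->
    mdist (w i (a, b)) (w i (c, d)) < r) ->
  pair_hyperspace P -> pair_hyperspace Q ->
  pair_dist P Q <= r -> pair_dist (pair_ifs P) (pair_ifs Q) < r.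
Proof.
move=> H HP HQ; have [[P1 P2] [Q1 Q2]] := (HP, HQ).
have [[TP1 TP2] [TQ1 TQ2]] := (pair_ifs_hyperspace HP, pair_ifs_hyperspace HQ).
rewrite ge_max => /andP[d1 d2]; rewrite gt_max.
by rewrite !ifs_image_hausdorff_lt.
Qed.

Lemma pair_ifs_le (r e : R) P Q :
  (forall i a b c d, mdist a c <= r -> mdist b d <= r ->
    mdist (w i (a, b)) (w i (c, d)) <= e) ->
  pair_hyperspace P -> pair_hyperspace Q ->
  pair_dist P Q <= r -> pair_dist (pair_ifs P) (pair_ifs Q) <= e.
Proof.
move=> H HP HQ; have [[P1 P2] [Q1 Q2]] := (HP, HQ).
have [[TP1 TP2] [TQ1 TQ2]] := (pair_ifs_hyperspace HP, pair_ifs_hyperspace HQ).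
rewrite ge_max => /andP[d1 d2]; rewrite ge_max.
by rewrite !(ifs_image_hausdorff_le H).
Qed.

End pair_ifs.

(* psi and phi are functions on (0, oo): only their values at positive
   arguments are used. *)
Theorem theorem5p2 (R : realType) (X : completeMetricType R)
  (N : nat) (hN : (1 <= N)%N)
  (psi : R -> R) (phi : 'I_N -> R -> R) (w : 'I_N -> X * X -> X)
  (w_continuous : forall i, continuous (w i))
  (w_contractive : forall i (x y u v : X),
    0 < mdist (w i (x, y)) (w i (u, v)) ->
    psi (mdist (w i (x, y)) (w i (u, v)))
      <= phi i (Num.max (mdist x u) (mdist y v)))
  (psi_nondecreasing : forall s t : R, 0 < s -> s <= t -> psi s <= psi t)
  (phi_nondecreasing : forall i (s t : R),
    0 < s -> s <= t -> phi i s <= phi i t)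
  (phi_lt_psi : forall i (t : R), 0 < t -> phi i t < psi t)
  (limsup_phi_lt_psi : forall i (e : R), 0 < e ->
    (limf_esup (fun t => (phi i t)%:E) e^'+
      < (lim (psi t @[t --> e^'+]))%:E)%E) :
  exists Astar Bstar : set X,
    [/\ unique (fun AB : set X * set X =>
          [/\ hyperspace AB.1, hyperspace AB.2,
              AB.1 = ifs_image w AB.1 AB.2
            & AB.2 = ifs_image w AB.2 AB.1]) (Astar, Bstar)
      & forall A B : set X, hyperspace A -> hyperspace B ->
        forall A_ B_ : nat -> set X,
        A_ 0%N = A -> B_ 0%N = B ->
        (forall n, A_ n.+1 = ifs_image w (A_ n) (B_ n)) ->
        (forall n, B_ n.+1 = ifs_image w (B_ n) (A_ n)) ->
        hyperspace_cvg A_ Astar /\ hyperspace_cvg B_ Bstar].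

Proof.
pose T := pair_ifs w.
have T_hyper := pair_ifs_hyperspace hN w_continuous.
have T_lt P Q : pair_hyperspace P -> pair_hyperspace Q -> 0 < pair_dist P Q ->
    pair_dist (T P) (T Q) < pair_dist P Q.
  move=> HP HQ PQ; apply: pair_ifs_lt => //.
  exact: (w_lt w_contractive psi_nondecreasing phi_nondecreasing phi_lt_psi PQ).
have T_mk e : 0 < e -> exists2 delta, 0 < delta & forall P Q,
    pair_hyperspace P -> pair_hyperspace Q ->
    pair_dist P Q < e + delta -> pair_dist (T P) (T Q) <= e.
  move=> /(w_meir_keeler w_contractive psi_nondecreasing phi_nondecreasing
    limsup_phi_lt_psi)[delta delta0 H].
  exists delta => // P Q HP HQ PQ; exact: pair_ifs_le (H _ PQ) HP HQ (lexx _).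
have Titer n P : pair_hyperspace P -> pair_hyperspace (iter n T P).
  exact: iter_stable.
have T_cvg0 P Q : pair_hyperspace P -> pair_hyperspace Q ->
    pair_dist (iter n T P) (iter n T Q) @[n --> \oo] --> (0 : R).
  by apply: iter_cvg0 => //; exact: pair_dist_ge0.
(* Any starting pair would do for existence; singletons of the base point are compact. *)
have P0_hyper : pair_hyperspace ([set point : X], [set point : X]).
  by split; split; [exists point|exact: compact_set1
                   |exists point|exact: compact_set1].
set P0 := ([set point], _) in P0_hyper.
have P0_cauchy (e : R) : 0 < e -> exists n, forall m, (n < m)%N ->
    pair_dist (iter n T P0) (iter m T P0) <= e.
  by apply: (iter_cauchy (D := pair_hyperspace (X := X))) => //;
    [exact: pair_dist_ge0|exact: pair_dist_triangle].
have [L HL P0_cvg] := pair_hyperspace_complete (fun n => Titer n _ P0_hyper)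
  P0_cauchy.
have TL : L = T L.
  apply: pair_dist_eq0 => //; first exact: T_hyper.
  by apply: (iter_lim_fixed (D := pair_hyperspace (X := X))) P0_cvg => //;
    [exact: pair_dist_ge0|exact: pair_dist_triangle|exact: pair_dist_sym].
have TnL n : iter n T L = L by rewrite iter_fix.
exists L.1, L.2; rewrite -surjective_pairing; split.
  split=> [|[A B] /= [HA HB AE BE]].
    by case: HL => HL1 HL2; split => //; [rewrite {1}TL|rewrite {1}TL].
  have HAB : pair_hyperspace (A, B) by [].
  have TAB n : iter n T (A, B) = (A, B) by rewrite iter_fix// /T/pair_ifs/= -AE -BE.
  (* Both orbits are constant while their distance tends to 0, so that distance is 0. *)
  apply: pair_dist_eq0 => //.
  have := T_cvg0 _ _ HL HAB; under eq_fun do rewrite TnL TAB.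
  by move=> /(cvg_unique _ (cvg_cst _)) <-.
move=> A B HA HB A_ B_ A0 B0 AS BS.
have AB_iter n : iter n T (A, B) = (A_ n, B_ n).
  by elim: n => [|n IH]; rewrite ?A0 ?B0// iterS IH AS BS.
(* Approaching the constant orbit of [L] is convergence to [L]. *)
have := T_cvg0 (A, B) L (conj HA HB) HL.
under eq_fun do rewrite AB_iter TnL.
move=> /pair_dist_cvg0P; apply => // n; rewrite -AB_iter; exact: Titer.
Qed.
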